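(* The theory $\mathbf{V}\cup\mathbf{K}\cup\mathbf{KK}$ is not generic.
   Context: Fix a nonempty set of symbols called propositional atoms and a symbol $\mathrm{K}$ which is not a propositional atom. Formulas are defined recursively: every propositional atom is a formula; if $\varphi,\psi$ are formulas then so are $\neg\varphi$, $(\varphi\wedge\psi)$, $(\varphi\vee\psi)$, $(\varphi\rightarrow\psi)$; if $\varphi$ is a formula then so is $\mathrm{K}(\varphi)$. A formula is basic if it is a propositional atom or of the form $\mathrm{K}\varphi$. A theory is a set of formulas. A model is a function assigning a truth value to every basic formula; truth $\mathscr M\models\varphi$ of an arbitrary formula is defined from the values of basic formulas by the classical truth tables (formulas $\mathrm{K}\varphi$ are treated like atoms). $\mathscr M\models T$ means $\mathscr M\models\varphi$ for all $\varphi\in T$; $T\models\varphi$ means every model of $T$ satisfies $\varphi$; $\varphi$ is valid if $\emptyset\models\varphi$. $\mathbf{V}=\{\mathrm{K}\varphi:\varphi\text{ valid}\}$; $\mathbf{K}=\{\mathrm{K}(\varphi\rightarrow\psi)\rightarrow(\mathrm{K}\varphi\rightarrow\mathrm{K}\psi)\}$; $\mathbf{KK}=\{\mathrm{K}\varphi\rightarrow\mathrm{K}\mathrm{K}\varphi\}$ (all formulas of these forms). For a theory $T$ and a set $S$ of propositional atoms, $\mathscr M_{T,S}$ is the model with $\mathscr M_{T,S}\models p$ iff $p\in S$ for atoms $p$, and $\mathscr M_{T,S}\models\mathrm{K}\varphi$ iff $T\models\varphi$. A theory $T$ is generic if for every set $S$ of propositional atoms and every theory $T'\supseteq T$, $\mathscr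 M_{T',S}\models T$. *)

(* Defs.v *)
From mathcomp Require Import all_boot.
From mathcomp Require Import boolp classical_sets.

Set Implicit Arguments.
Unset Strict Implicit.
Unset Printing Implicit Defensive.

Local Open Scope classical_set_scope.

Inductive formula (A : Type) : Type :=
  | Atom of A
  | Neg of formula A
  | And of formula A & formula A
  | Or of formula A & formula A
  | Imp of formula A & formula A
  | Know of formula A.

Definition basic (A : Type) (f : formula A) : bool :=
  match f with
  | Atom _ | Know _ => true
  | _ => false
  end.

Definition theory (A : Type) := set (formula A).

Definition model (A : Type) := {f : formula A | basic f} -> bool.

Fixpoint sat (A : Type) (M : model A) (f : formula A) : bool :=
  match f with
  | Atom a => M (exist _ (Atom a) isT)
  | Neg g => ~~ sat M g
  | And g h => sat M g && sat M h
  | Or g h => sat M g || sat M h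
  | Imp g h => sat M g ==> sat M h
  | Know g => M (exist _ (Know g) isT)
  end.

Definition models (A : Type) (M : model A) (T : theory A) : Prop :=
  forall f, T f -> sat M f.

Definition entails (A : Type) (T : theory A) (f : formula A) : Prop :=
  forall M : model A, models M T -> sat M f.

Definition valid (A : Type) (f : formula A) : Prop := entails set0 f.

Definition axV (A : Type) : theory A :=
  [set Know f | f in [set f | @valid A f]].

Definition axK (A : Type) : theory A :=
  [set x | exists f g : formula A,
     x = Imp (Know (Imp f g)) (Imp (Know f) (Know g))].

Definition axKK (A : Type) : theory A :=
  [set x | exists f : formula A, x = Imp (Know f) (Know (Know f))].

Arguments axV : clear implicits.
Arguments axK : clear implicits.
Arguments axKK : clear implicits.

(* The last branch is never reached: the argument is a basic formula. *)
Definition canonical_model (A : Type) (T : theory A) (S : set A) : model A :=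
  fun b => match sval b with
           | Atom a => `[< S a >]
           | Know f => `[< entails T f >]
           | _ => false
           end.

Definition generic (A : Type) (T : theory A) : Prop :=
  forall (S : set A) (T' : theory A), T `<=` T' ->
    models (canonical_model T' S) T.

(* Main.v *)
(* Let T be the theory and p an atom, and take T' = T + p.  In the canonical
   model of T', the KK axiom for p says that T' |= p implies T' |= K p.  But
   T' |= p trivially, while T' does not entail K p: consider the S5 Kripke model
   with two mutually accessible worlds, p holding at exactly one of them.  Seen
   from the world where p holds, it satisfies T' and refutes K p. *)
Require Import Defs.
From mathcomp Require Import all_boot.
From mathcomp Require Import boolp classical_sets.

Local Open Scope classical_set_scope.

(* The two worlds are the booleans, and every atom holds exactly at [true]. *)
Fixpoint holds_at (A : Type) (w : bool) (f : formula A) : bool :=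
  match f with
  | Atom _ => w
  | Neg g => ~~ holds_at A w g
  | And g h => holds_at A w g && holds_at A w h
  | Or g h => holds_at A w g || holds_at A w h
  | Imp g h => holds_at A w g ==> holds_at A w h
  | Know g => holds_at A true g && holds_at A false g
  end.

Arguments holds_at {A} w f.

Definition world_model (A : Type) (w : bool) : model A :=
  fun b => holds_at w (sval b).

(** [holds_at] obeys the truth tables, so its values on basic formulas determine it. *)
Lemma sat_world_model (A : Type) (w : bool) (f : formula A) :
  sat (world_model A w) f = holds_at w f.
Proof. by elim: f => //= [g ->|g -> h ->|g -> h ->|g -> h ->]. Qed.

(** Valid formulas are true in both world models, hence at both worlds; truth at both worlds is
    closed under modus ponens; and [Know f] has the same value at each world. *)
Lemma world_model_VKKK (A : Type) (w : bool) :
  models (world_model A w) (axV A `|` axK A `|` axKK A).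
Proof.
move=> _ [[[f f_valid <-]|[f [g ->]]]|[f ->]]; rewrite sat_world_model /=.
- by rewrite -!sat_world_model !f_valid.
- by case: (holds_at true f); case: (holds_at false f);
    case: (holds_at true g); case: (holds_at false g).
- by case: (holds_at true f); case: (holds_at false f).
Qed.

Theorem theorem21 (A : Type) (hA : inhabited A) :
  ~ generic (axV A `|` axK A `|` axKK A).
Proof.
case: hA => a T_generic.
set T := axV A `|` axK A `|` axKK A in T_generic.
pose T' : theory A := T `|` [set Atom a].
have T'_sub : T `<=` T' by move=> f; left.
have KKa : T (Imp (Know (Atom a)) (Know (Know (Atom a)))).
  by right; exists (Atom a).
have /= /implyP KK := T_generic set0 T' T'_sub _ KKa.
have T'a : entails T' (Atom a) by move=> M; apply; right.
have /asboolP/(_ (world_model A true)) T'Ka := KK (asboolT T'a).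
(* Here [Know (Atom a)] computes to [false], since the atom fails at the world [false]. *)
suff /T'Ka : models (world_model A true) T' by [].
by move=> f [/world_model_VKKK//|->].
Qed.
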